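(* Let $n\ge1$. Among all words in $\mathbf c,\mathbf d$ of degree $2n+2$, the word $\mathbf c\mathbf d^n\mathbf c$ has the maximum value of $\beta$. Among all words in $\mathbf c,\mathbf d$ of degree $2n+5$, the words $\mathbf c\mathbf d\mathbf c\mathbf d^n\mathbf c$ and $\mathbf c\mathbf d^n\mathbf c\mathbf d\mathbf c$ have the maximum value of $\beta$.
   Context: $\deg\mathbf c=1$, $\deg\mathbf d=2$. For a graded poset $P$ of rank $r+1$ with $\hat0,\hat1$ and $S\subseteq[r]$, $f_S$ counts chains $\hat0<x_1<\dots<x_j<\hat1$ with rank set $S$, $h_S=\sum_{T\subseteq S}(-1)^{|S-T|}f_T$, and the ab-index is $\sum_S h_S u_1\cdots u_r$ with $u_i=\mathbf b$ if $i\in S$, $\mathbf a$ otherwise. For Eulerian $P$ it is uniquely a polynomial $\Psi(P)$ in the non-commuting variables $\mathbf c=\mathbf a+\mathbf b$, $\mathbf d=\mathbf a\mathbf b+\mathbf b\mathbf a$. $B_{r+1}$ is the Boolean lattice of subsets of $[r+1]$. For a word $v$ of degree $r$, $\beta(v)$ is the coefficient of $v$ in $\Psi(B_{r+1})$. *)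

(* Defs.v *)
From HB Require Import structures.
From mathcomp Require Import all_boot all_order all_algebra.
From mathcomp Require Import finmap.
From mathcomp.multinomials Require Import monalg.
From Stdlib Require Import ClassicalEpsilon.

Set Implicit Arguments.
Unset Strict Implicit.
Unset Printing Implicit Defensive.

Import Order.TTheory GRing.Theory Num.Theory.
Local Open Scope ring_scope.

Variant ab_letter := La | Lb.

Definition ab_to_bool x := if x is Lb then true else false.
Definition ab_of_bool (t : bool) := if t then Lb else La.
Lemma ab_to_boolK : cancel ab_to_bool ab_of_bool.
Proof. by case. Qed.
HB.instance Definition _ := Choice.copy ab_letter (can_type ab_to_boolK).

Variant cd_letter := Lc | Ld.

Definition cd_to_bool x := if x is Ld then true else false.
Definition cd_of_bool (t : bool) := if t then Ld else Lc.
Lemma cd_to_boolK : cancel cd_to_bool cd_of_bool.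
Proof. by case. Qed.
HB.instance Definition _ := Choice.copy cd_letter (can_type cd_to_boolK).

(* The free rings Z<a,b> and Z<c,d>: monoid rings of the free monoids. *)
Notation ab_poly := {malg int[{fmonom ab_letter}]}.
Notation cd_poly := {malg int[{fmonom cd_letter}]}.

Definition va : ab_poly := << FMonom [:: La] >>.
Definition vb : ab_poly := << FMonom [:: Lb] >>.

Definition cd_deg (w : seq cd_letter) : nat :=
  \sum_(x <- w) (if x is Ld then 2 else 1)%N.

(* The ring morphism Z<c,d> -> Z<a,b> with c |-> a + b and d |-> ab + ba. *)
Definition cd_subst_word (w : {fmonom cd_letter}) : ab_poly :=
  \prod_(x <- fmonom_val w) (if x is Ld then va * vb + vb * va else va + vb).

Definition cd_subst (Phi : cd_poly) : ab_poly := mmap intr cd_subst_word Phi.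

Section FlagVectors.
Variables (disp : Order.disp_t) (P : finTBPOrderType disp).

Definition is_chain (C : {set P}) : bool :=
  [forall x in C, forall y in C, (x >=< y)%O].

(* The length of a longest chain from \bot to x; when P is graded, this is the
   rank of x. *)
Definition poset_rank (x : P) : nat :=
  \max_(C : {set P} | is_chain C && [forall y in C, (y < x)%O]) #|C|.

(* The r such that P has rank r + 1. *)
Definition inner_rank : nat := (poset_rank \top%O).-1.

(* A set of ranks S <= [r] is a {set 'I_inner_rank}: the ordinal i stands for
   the rank i + 1. *)
Definition has_rank_set (C : {set P}) (S : {set 'I_inner_rank}) : bool :=
  [forall i, (i \in S) == [exists x in C, poset_rank x == i.+1]].

Definition flag_f (S : {set 'I_inner_rank}) : nat :=
  #|[set C : {set P} | [&& is_chain C, \bot%O \notin C, \top%O \notin C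
                         & has_rank_set C S]]|.

Definition flag_h (S : {set 'I_inner_rank}) : int :=
  \sum_(T : {set 'I_inner_rank} | T \subset S)
     (-1) ^+ #|S :\: T| * (flag_f T)%:R.

Definition ab_index : ab_poly :=
  \sum_(S : {set 'I_inner_rank})
     flag_h S *: \prod_(i < inner_rank) (if i \in S then vb else va).

Definition is_cd_index (Phi : cd_poly) : Prop := cd_subst Phi = ab_index.

(* Meaningful when such a Phi exists, e.g. for P Eulerian; it is then unique. *)
Definition cd_index : cd_poly := epsilon (inhabits 0) is_cd_index.

End FlagVectors.

(* Orders {set T} by inclusion. *)
Import Order.DefaultSetSubsetOrder.

Definition boolean_lattice (n : nat) :
    finTBPOrderType Order.SetSubsetOrder.subset_display := {set 'I_n}.

Definition beta (v : seq cd_letter) : int :=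
  (cd_index (boolean_lattice (cd_deg v).+1))@_(FMonom v).

(* Main.v *)
Require Import Defs.
From mathcomp Require Import all_boot all_order all_algebra.
From mathcomp Require Import finmap.
From mathcomp.multinomials Require Import monalg.
From mathcomp Require Import zify ring lra.
From Stdlib Require Import ClassicalEpsilon.
Set Implicit Arguments.
Unset Strict Implicit.
Unset Printing Implicit Defensive.
Import Order.TTheory GRing.Theory Num.Theory.
Local Open Scope ring_scope.

(** The coefficients satisfy two rules.  The first, dual to the recurrence
    [Psi(B_(n+1)) = Psi(B_n) c + G(Psi(B_n))] with the derivation [G] given by
    [c |-> d], [d |-> cd], computes [beta v] from words of degree one less; it
    yields [beta (u cc v) <= beta (u d v)] by induction, so only words without
    [cc] compete.  The second, for [b v = beta v / (deg v + 1)!], is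
    [b u * b v = 2 b (u c v)], plus [b (u' d v)] if [u = u' c], plus [b (u d v')]
    if [v = c v'].  Hence on a word without [cc], [b] is, up to a power of 2, the
    product of the numbers [b (d^a)] over its maximal blocks of [d]'s.  These are
    the coefficients of [tan] up to powers of 2; they are log-convex and their
    ratios are well controlled, which locates the maximum.  The second rule also
    identifies the recursively defined coefficients with those of the cd-index: it
    translates into [h (u a v) + h (u b v) = 'C(|u| + |v| + 2, |u| + 1) h u * h v]
    for the flag h-vector, that is, into the multinomial formula for the flag
    f-vector of the Boolean lattice. *)

(** * The coefficients as a recursion on words *)

Lemma cd_deg_nil : cd_deg [::] = 0%N.
Proof. by rewrite /cd_deg big_nil. Qed.

Lemma cd_deg_cons x v : cd_deg (x :: v) = ((if x is Ld then 2 else 1) + cd_deg v)%N.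
Proof. by rewrite /cd_deg big_cons. Qed.

Lemma cd_deg_cat u v : cd_deg (u ++ v) = (cd_deg u + cd_deg v)%N.
Proof. by rewrite /cd_deg big_cat. Qed.

Lemma cd_deg_nseqd n : cd_deg (nseq n Ld) = (2 * n)%N.
Proof. by elim: n => [|n IHn]; rewrite /= ?cd_deg_nil // cd_deg_cons IHn; lia. Qed.

Lemma cd_deg_eq0 v : (cd_deg v == 0%N) = (v == [::]).
Proof. by case: v => [|x v]; rewrite ?cd_deg_nil // cd_deg_cons; case: x. Qed.

(** In [lower] this singles out the last [c] of a run: only that one can be the appended [c], or the
    [c] created by [d |-> cd]. *)
Definition starts_c (v : seq cd_letter) := if v is Lc :: _ then true else false.

(* The words of degree one less from which [v] arises: appending a [c], turning
   a [c] into [d], or a [d] into [cd]. *)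
Fixpoint lower (v : seq cd_letter) : seq (seq cd_letter) :=
  match v with
  | [::] => [::]
  | Lc :: v' => map (cons Lc) (lower v') ++ (if starts_c v' then [::] else [:: v'])
  | Ld :: v' => (Lc :: v') :: map (cons Ld) (lower v')
  end.

Lemma cd_deg_lower v w : w \in lower v -> cd_deg v = (cd_deg w).+1.
Proof.
elim: v w => [|[] v IHv] w //=.
- rewrite mem_cat => /orP[/mapP[w' /IHv dw ->]|]; first by rewrite !cd_deg_cons dw.
  by case: (starts_c v) => //; rewrite inE => /eqP ->; rewrite cd_deg_cons.
- rewrite inE => /orP[/eqP ->|/mapP[w' /IHv dw ->]]; rewrite !cd_deg_cons //.
  by rewrite dw; lia.
Qed.

(** The fuel [n] is meant to be the degree of [v], which each step of [lower] decreases by one; the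
    value 1 is the coefficient of the empty word. *)
Fixpoint beta_rec n v : nat :=
  if n is n'.+1 then \sum_(w <- lower v) beta_rec n' w else 1.

Definition beta0 v := beta_rec (cd_deg v) v.

Lemma beta0_nil : beta0 [::] = 1%N.
Proof. by rewrite /beta0 cd_deg_nil. Qed.

Lemma beta0E v : v != [::] -> beta0 v = (\sum_(w <- lower v) beta0 w)%N.
Proof.
rewrite -cd_deg_eq0 /beta0; case def_n: (cd_deg v) => [|n] // _ /=.
by apply: eq_big_seq => w /cd_deg_lower; rewrite def_n => -[->].
Qed.

Lemma big_lower_c (K : seq cd_letter -> nat) v :
  (\sum_(w <- lower (Lc :: v)) K w =
   \sum_(w <- lower v) K (Lc :: w) + (if starts_c v then 0 else K v))%N.
Proof. by rewrite /= big_cat big_map; case: ifP; rewrite ?big_nil ?big_seq1. Qed.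

Lemma big_lower_d (K : seq cd_letter -> nat) v :
  (\sum_(w <- lower (Ld :: v)) K w =
   K (Lc :: v) + \sum_(w <- lower v) K (Ld :: w))%N.
Proof. by rewrite /= big_cons big_map. Qed.


Arguments lower : simpl never.

(** Predecessors are matched one by one: changes inside [u] or [v] fall under the hypothesis, and at
    the marked place [c v] is always a predecessor of [d v], but of [c c v] only if [v] does not
    start with [c]. The function [K] is arbitrary so that the induction on [u] can absorb the first
    letter into it. *)
Lemma big_lower_cc_le (K : seq cd_letter -> nat) u v :
  (forall u' v', (cd_deg u' + cd_deg v' < cd_deg u + cd_deg v)%N ->
     (K (u' ++ [:: Lc, Lc & v']) <= K (u' ++ Ld :: v'))%N) ->
  (\sum_(w <- lower (u ++ [:: Lc, Lc & v])) K w <=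
   \sum_(w <- lower (u ++ Ld :: v)) K w)%N.
Proof.
elim: u K => [|x u IHu] K hypK.
  rewrite !cat0s big_lower_d !big_lower_c /= addn0 addnC leq_add //.
    by case: ifP.
  rewrite !(big_seq_cond xpredT); apply: leq_sum => w; rewrite andbT => /cd_deg_lower dw.
  by apply: (hypK [::]); rewrite cd_deg_nil dw.
have IH := IHu (K \o cons x); case: x => [|] in hypK IH *; rewrite !cat_cons.
  rewrite !big_lower_c; apply: leq_add.
    by apply: IH => u' v' lt /=; apply: (hypK (Lc :: u')); rewrite !cd_deg_cons; lia.
  by case: u hypK {IHu IH} => [|[] u] //= hypK; apply: (hypK (Ld :: u)); rewrite !cd_deg_cons; lia.
rewrite !big_lower_d; apply: leq_add; last first.
  by apply: IH => u' v' lt /=; apply: (hypK (Ld :: u')); rewrite !cd_deg_cons; lia.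
by apply: (hypK (Lc :: u)); rewrite !cd_deg_cons; lia.
Qed.

Lemma beta0_cc_le u v : (beta0 (u ++ [:: Lc, Lc & v]) <= beta0 (u ++ Ld :: v))%N.
Proof.
have [n] := ubnP (cd_deg u + cd_deg v)%N; elim: n => // n IHn in u v *.
rewrite ltnS => le_n; rewrite !beta0E; try by case: (u).
by apply: big_lower_cc_le => u' v' lt; apply: IHn; apply: leq_trans le_n.
Qed.

(* The product of (the coefficient functionals of) [u] and [v]: twice [u c v],
   plus [u' d v] if [u = u' c], plus [u d v'] if [v = c v']. *)
Definition glue0 v : seq (seq cd_letter) :=
  [:: Lc :: v; Lc :: v] ++ (if v is Lc :: v' then [:: Ld :: v'] else [::]).

Fixpoint glue (u v : seq cd_letter) : seq (seq cd_letter) :=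
  if u is x :: u' then
    map (cons x) (glue u' v) ++ (if u is [:: Lc] then [:: Ld :: v] else [::])
  else glue0 v.

Lemma glue_cons x u v : glue (x :: u) v =
  map (cons x) (glue u v) ++ (if x :: u is [:: Lc] then [:: Ld :: v] else [::]).
Proof. by []. Qed.

Lemma big_glue0 (K : seq cd_letter -> nat) v :
  (\sum_(w <- glue [::] v) K w =
   2 * K (Lc :: v) + (if v is Lc :: v' then K (Ld :: v') else 0))%N.
Proof.
rewrite /= !big_cons addnA addnn -mul2n.
by case: v => [|[] v]; rewrite ?big_nil ?big_seq1.
Qed.

Lemma big_glue1 (K : seq cd_letter -> nat) v :
  (\sum_(w <- glue [:: Lc] v) K w =
   \sum_(w <- glue [::] v) K (Lc :: w) + K (Ld :: v))%N.
Proof. by rewrite glue_cons big_cat big_map big_seq1. Qed.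

Lemma big_glue_c (K : seq cd_letter -> nat) u v : u != [::] ->
  (\sum_(w <- glue (Lc :: u) v) K w = \sum_(w <- glue u v) K (Lc :: w))%N.
Proof. by case: u => // x u _; rewrite glue_cons cats0 big_map. Qed.

Lemma big_glue_d (K : seq cd_letter -> nat) u v :
  (\sum_(w <- glue (Ld :: u) v) K w = \sum_(w <- glue u v) K (Ld :: w))%N.
Proof. by rewrite glue_cons cats0 big_map. Qed.

Arguments glue : simpl never.

(* [lower] acts on a glued word as a derivation; the empty word, on which
   [lower] vanishes, contributes the other argument instead. *)
Lemma lower_glue (K : seq cd_letter -> nat) u v :
  (\sum_(w <- glue u v) \sum_(w' <- lower w) K w' =
   (if u is [::] then K v else \sum_(u1 <- lower u) \sum_(w <- glue u1 v) K w) +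
   (if v is [::] then K u else \sum_(v1 <- lower v) \sum_(w <- glue u v1) K w))%N.
Proof.
have glueE K' x u' w' : (\sum_(w <- glue (x :: u') w') K' w =
    \sum_(w <- glue u' w') K' (x :: w) +
    (if x :: u' is [:: Lc] then K' (Ld :: w') else 0))%N.
  by case: x u' => [] [|y u']; rewrite ?big_glue1 ?big_glue_d ?big_glue_c ?addn0.
have base K' : (\sum_(w <- glue [::] v) \sum_(w' <- lower w) K' w' =
   K' v + (if v is [::] then K' [::] else
     \sum_(v1 <- lower v) \sum_(w <- glue [::] v1) K' w))%N.
  rewrite big_glue0 big_lower_c.
  have -> : (\sum_(v1 <- lower v) \sum_(w <- glue [::] v1) K' w =
    2 * \sum_(v1 <- lower v) K' (Lc :: v1) +
    \sum_(v1 <- lower v) (if v1 is Lc :: v' then K' (Ld :: v') else 0))%N.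
    rewrite big_distrr -big_split; apply: eq_bigr => w _; exact: big_glue0.
  case: v => [|[] v'].
  - by rewrite big_nil /=; lia.
  - rewrite big_lower_d [X in (_ = _ + (_ + X))%N]big_lower_c /=.
    have -> : (if starts_c v' then 0%N else
      if v' is Lc :: v'' then K' (Ld :: v'') else 0%N) = 0%N by case: v' => [|[] v''].
    by ring.
  - by rewrite [X in (_ = _ + (_ + X))%N]big_lower_d /= big1_eq; ring.
elim: u K => [|x u IHu] K; first exact: base.
case: x.
- case: u IHu => [|y u] IHu.
    rewrite big_glue1 (eq_bigr _ (fun w _ => big_lower_c K w)) big_split /=.
    rewrite (base (K \o cons Lc)) big_lower_d big_lower_c !big_nil add0n /=.
    have -> : (\sum_(w <- glue [::] v) (if starts_c w then 0 else K w))%N =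
       (if v is Lc :: v' then K (Ld :: v') else 0%N).
      by rewrite big_glue0; case: (v) => [|[] v'].
    have -> : (if v is [::] then K [:: Lc] else
       \sum_(v1 <- lower v) \sum_(w <- glue [:: Lc] v1) K w)%N =
       ((if v is [::] then K [:: Lc] else
       \sum_(v1 <- lower v) \sum_(w <- glue [::] v1) K (Lc :: w)) +
        \sum_(v1 <- lower v) K (Ld :: v1))%N.
      case: (v) => [|z v'] ; first by rewrite big_nil addn0.
      by rewrite -big_split; apply: eq_bigr => w _; rewrite big_glue1.
    by rewrite [in RHS]big_glue0; ring.
  rewrite big_glue_c // (eq_bigr _ (fun w _ => big_lower_c K w)) big_split /=.
  rewrite (IHu (K \o cons Lc)) big_lower_c /=.
  (* Glued words keep the first letter [y], except for the extra word [d v] produced when the left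
     factor is a single [c]. *)
  have -> : (\sum_(w <- glue (y :: u) v) (if starts_c w then 0 else K w) =
    (if y is Lc then 0 else \sum_(w <- glue (y :: u) v) K w) +
    (if y :: u is [:: Lc] then K (Ld :: v) else 0))%N.
    case: y {IHu}; last by rewrite !big_glue_d addn0.
    by rewrite glueE big1_eq /=; case: (u).
  (* The same extra term arises here from [u1] empty, which occurs only when [y :: u] is a single
     [c]. *)
  have -> : (\sum_(u1 <- lower (y :: u)) \sum_(w <- glue (Lc :: u1) v) K w =
   \sum_(u1 <- lower (y :: u)) \sum_(w <- glue u1 v) K (Lc :: w) +
   (if y :: u is [:: Lc] then K (Ld :: v) else 0))%N.
    rewrite -[X in _ = (_ + X)%N](_ : \sum_(u1 <- lower (y :: u))
       (if u1 is [::] then K (Ld :: v) else 0) = _)%N; last first.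
      case: y {IHu}; last by rewrite big_lower_d /= big1_eq.
      by rewrite big_lower_c big1_eq; case: u => [|[] u].
    by rewrite -big_split; apply: eq_bigr => -[|x' u'] _; rewrite glueE.
  have -> : (\sum_(v1 <- lower v) \sum_(w <- glue (Lc :: y :: u) v1) K w =
     \sum_(v1 <- lower v) \sum_(w <- glue (y :: u) v1) K (Lc :: w))%N.
    by apply: eq_bigr => w _; rewrite big_glue_c.
  by case: y {IHu}; case: (u) => [|? ?] /=; ring.
- rewrite big_glue_d (eq_bigr _ (fun w _ => big_lower_d K w)) big_split /=.
  rewrite (IHu (K \o cons Ld)) big_lower_d glueE /=.
  have -> : (\sum_(u1 <- lower u) \sum_(w <- glue (Ld :: u1) v) K w =
     \sum_(u1 <- lower u) \sum_(w <- glue u1 v) K (Ld :: w))%N.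
    by apply: eq_bigr => w _; rewrite big_glue_d.
  have -> : (\sum_(v1 <- lower v) \sum_(w <- glue (Ld :: u) v1) K w =
     \sum_(v1 <- lower v) \sum_(w <- glue u v1) K (Ld :: w))%N.
    by apply: eq_bigr => w _; rewrite big_glue_d.
  by case: u {IHu} => [|z u] /=; rewrite ?big_nil; ring.
Qed.

Lemma glue_neq0 u v w : w \in glue u v -> w != [::].
Proof.
case: u => [|x u]; rewrite ?glue_cons.
  by rewrite !inE => /or3P[/eqP->|/eqP->|] //; case: v => // -[] // v; rewrite inE => /eqP->.
rewrite mem_cat => /orP[/mapP[? _ ->]//|].
by case: x u => // -[] //; rewrite inE => /eqP ->.
Qed.

(** By induction on the total degree: [lower_glue] separates lowering [u] from lowering [v], and the
    two parts carry the two binomials of Pascal's rule. When a factor is empty its binomial is 1, in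
    accordance with the exceptional term of [lower_glue]. *)
Lemma beta0_mul u v :
  (\sum_(w <- glue u v) beta0 w =
   'C(cd_deg u + cd_deg v + 2, (cd_deg u).+1) * (beta0 u * beta0 v))%N.
Proof.
have [n] := ubnP (cd_deg u + cd_deg v)%N; elim: n => // n IHn in u v *.
rewrite ltnS => le_n.
rewrite (eq_big_seq (fun w => \sum_(w' <- lower w) beta0 w')%N); last first.
  by move=> w /glue_neq0; exact: beta0E.
rewrite lower_glue addn2 binS mulnDl addnC.
congr (_ + _)%N.
- case: v le_n => [|y v] le_n.
    by rewrite beta0_nil cd_deg_nil addn0 binn muln1 mul1n.
  have nv: y :: v != [::] by [].
  rewrite [in RHS](beta0E nv) !big_distrr /=.
  apply: eq_big_seq => w /cd_deg_lower dw; rewrite IHn; last by rewrite dw in le_n; lia.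
  by rewrite dw addn2 addnS.
- case: u le_n => [|y u] le_n.
    by rewrite beta0_nil cd_deg_nil bin0 !mul1n.
  have nu: y :: u != [::] by [].
  rewrite [in RHS](beta0E nu) big_distrl big_distrr /=.
  apply: eq_big_seq => w /cd_deg_lower dw; rewrite IHn; last by rewrite dw in le_n; lia.
  by rewrite dw addn2 addSn.
Qed.

(** * Comparison of words *)

Definition nbeta v : rat := (beta0 v)%:R / ((cd_deg v).+1)`!%:R.

Lemma factr_gt0 n : 0 < n`!%:R :> rat.
Proof. by rewrite ltr0n fact_gt0. Qed.

Lemma nbeta_lower v : v != [::] ->
  (cd_deg v).+1%:R * nbeta v = \sum_(w <- lower v) nbeta w.
Proof.
move=> nv; rewrite /nbeta (beta0E nv) factS natrM invfM natr_sum mulrA.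
rewrite (mulrC _%:R) -!mulrA (mulrA _.+1%:R) divff ?mul1r ?pnatr_eq0 //.
rewrite big_distrl /=; apply: eq_big_seq => w /cd_deg_lower ->.
by [].
Qed.

Lemma glue_nseqd a v : ~~ starts_c v ->
  glue (nseq a Ld) v = [:: nseq a Ld ++ Lc :: v; nseq a Ld ++ Lc :: v].
Proof.
move=> nc; elim: a => [|a IHa]; last by rewrite glue_cons IHa.
by case: v nc => [|[] v].
Qed.

(** Gluing gives just two copies of the same word, hence the factor 1/2; the factorials in [nbeta]
    absorb the binomial of [beta0_mul]. *)
Lemma nbeta_nseqd_c a v : ~~ starts_c v ->
  nbeta (nseq a Ld ++ Lc :: v) = nbeta (nseq a Ld) * nbeta v / 2.
Proof.
move=> nc; have := beta0_mul (nseq a Ld) v; rewrite glue_nseqd // !big_cons big_nil.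
set u := nseq a Ld; set w := u ++ _ => eq_w.
have dw : (cd_deg w).+1 = (cd_deg u + cd_deg v + 2)%N.
  by rewrite cd_deg_cat cd_deg_cons /= add1n addnS addn2.
have le_u : ((cd_deg u).+1 <= cd_deg u + cd_deg v + 2)%N by lia.
have := bin_fact le_u.
have -> : (cd_deg u + cd_deg v + 2 - (cd_deg u).+1 = (cd_deg v).+1)%N by lia.
move=> eq_b; rewrite /nbeta dw -eq_b (natrM _ 'C(_, _)) (natrM _ _`! _`!).
have eq_wr : (beta0 w)%:R = ('C(cd_deg u + cd_deg v + 2, (cd_deg u).+1))%:R *
    ((beta0 u)%:R * (beta0 v)%:R) / 2 :> rat.
  by rewrite -!natrM -eq_w addn0 natrD; field.
rewrite {}eq_wr; have := factr_gt0 (cd_deg u).+1; have := factr_gt0 (cd_deg v).+1.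
have : 0 < ('C(cd_deg u + cd_deg v + 2, (cd_deg u).+1))%:R :> rat by rewrite ltr0n bin_gt0.
move: (((cd_deg u).+1)`!%:R) (((cd_deg v).+1)`!%:R) 'C(_, _)%:R => fu fv k k0 fv0 fu0.
by field; rewrite !gt_eqF.
Qed.

(** * The tangent coefficients: recurrence, log-convexity and ratio bounds *)

(* [2 ^+ n * tcoef n] is the coefficient of [x^(2n+1)] in [tan x]. *)
Definition tcoef n := nbeta (nseq n Ld).

Lemma big_lower_nseqd (V : nmodType) (K : seq cd_letter -> V) n :
  \sum_(w <- lower (nseq n Ld)) K w =
  \sum_(i < n) K (nseq i Ld ++ Lc :: nseq (n.-1 - i) Ld).
Proof.
elim: n K => [|n IHn] K; first by rewrite big_nil big_ord0.
rewrite big_cons big_map IHn big_ord_recl /= subn0; congr (_ + _).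
apply: eq_bigr => i _; rewrite /bump /= add1n.
by congr (K (Ld :: (_ ++ _ :: nseq _ _))); lia.
Qed.

Lemma starts_c_nseqd n : starts_c (nseq n Ld) = false.
Proof. by case: n. Qed.

(** Lowering a power of [d] turns one [d] into a [c], which cuts the word into two blocks. For the
    series [t] with coefficients [tcoef n] at [x^(2n+1)] this is the differential equation
    [t' = 1 + t^2 / 2]. *)
Lemma tcoefS n :
  (2 * n + 3)%:R * tcoef n.+1 = (\sum_(i < n.+1) tcoef i * tcoef (n - i)) / 2.
Proof.
have := @nbeta_lower (nseq n.+1 Ld) isT; rewrite cd_deg_nseqd.
have -> : (2 * n.+1).+1 = (2 * n + 3)%N by lia.
rewrite /tcoef => ->.
rewrite (big_lower_nseqd _ n.+1) big_distrl /=; apply: eq_bigr => i _.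
by rewrite nbeta_nseqd_c // starts_c_nseqd.
Qed.

Lemma tcoef0 : tcoef 0 = 1.
Proof. by rewrite /tcoef /nbeta beta0_nil cd_deg_nil. Qed.

Lemma tcoef1 : tcoef 1 = 1 / 6.
Proof.
by have := tcoefS 0; rewrite big_ord1 tcoef0 => eq1; lra.
Qed.

Lemma tcoef2 : tcoef 2 = 1 / 30.
Proof.
by have := tcoefS 1; rewrite !big_ord_recr big_ord0 /= tcoef0 tcoef1 => eq1; lra.
Qed.

Lemma tcoef3 : tcoef 3 = 17 / 2520.
Proof.
by have := tcoefS 2; rewrite !big_ord_recr big_ord0 /= tcoef0 tcoef1 tcoef2 => eq1; lra.
Qed.

Lemma tcoef4 : tcoef 4 = 31 / 22680.
Proof.
have := tcoefS 3; rewrite !big_ord_recr big_ord0 /= tcoef0 tcoef1 tcoef2 tcoef3 => eq1.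
by lra.
Qed.

Lemma tcoef_gt0 n : 0 < tcoef n.
Proof.
elim/ltn_ind: n => -[|n] IHn; first by rewrite tcoef0.
have n3 : 0 < (2 * n + 3)%:R :> rat by rewrite ltr0n; lia.
rewrite -(pmulr_rgt0 _ n3) tcoefS divr_gt0 // big_ord_recl ltr_pwDl //.
  by rewrite mulr_gt0 // IHn //= subn0.
by rewrite sumr_ge0 // => i _; rewrite mulr_ge0 // ltW // IHn //; have := ltn_ord i; lia.
Qed.

(** Log-convexity makes the successive ratios nondecreasing, written here without division. It is
    assumed only below [m], so that the lemma serves inside the induction proving log-convexity of
    [tcoef]. *)
Lemma logconvex_ratio (R : realFieldType) (x : nat -> R) m :
  (forall k, 0 < x k) -> (forall k, (k < m)%N -> x k.+1 ^+ 2 <= x k * x k.+2) ->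
  forall i, (i <= m)%N -> x i.+1 * x m <= x m.+1 * x i.
Proof.
move=> x0; elim: m => [|m IHm] hx i; first by rewrite leqn0 => /eqP ->.
rewrite leq_eqVlt => /orP[/eqP-> //|]; rewrite ltnS => le_i.
have := IHm (fun k lt => hx k (ltnW lt)) i le_i; have := hx m (ltnSn m).
move=> h1 h2; rewrite -(ler_pM2r (x0 m)).
apply: (@le_trans _ _ (x m.+1 ^+ 2 * x i)).
  by rewrite mulrAC expr2 -[leRHS]mulrA [leRHS]mulrC ler_pM2r.
by rewrite [leRHS]mulrAC ler_pM2r // mulrC.
Qed.

(* With [c = tcoef m.+1 / tcoef m] and [F] the generating polynomial, the
   recurrence turns [tcoef m * tcoef m.+2 - tcoef m.+1 ^+ 2] into a positive
   multiple of the coefficient of degree [m.+1] in [((1 - c X) F) ^+ 2].  The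
   coefficients of [(1 - c X) F] of positive degree are nonpositive, and the one
   of degree [m.+1] vanishes. *)
Lemma tcoef_logconvex m : tcoef m.+1 ^+ 2 <= tcoef m * tcoef m.+2.
Proof.
elim/ltn_ind: m => -[|m] IHm; first by rewrite tcoef0 tcoef1 tcoef2; lra.
have t0 := tcoef_gt0.
have ratio := logconvex_ratio t0 IHm.
(* The case treated is [m.+1], so the index and the ratio described above are shifted by one.
   Truncating [F] after degree [a] does not affect the coefficients up to [a]. *)
pose a := m.+2; pose c := tcoef m.+2 / tcoef m.+1.
pose F : {poly rat} := \poly_(i < a.+1) tcoef i.
pose E : {poly rat} := F - c *: ('X * F).
have coefF i : (i <= a)%N -> F`_i = tcoef i by rewrite coef_poly ltnS => ->.
have coefFF k : (k <= a)%N -> (F * F)`_k = 2 * ((2 * k + 3)%:R * tcoef k.+1).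
  move=> le_k; rewrite tcoefS mulrCA divff // mulr1 coefM; apply: eq_bigr => i _.
  by rewrite !coefF //; have := ltn_ord i; lia.
have coefE0 : E`_0 = 1 by rewrite coefB coefZ coefXM coefF //= mulr0 subr0 tcoef0.
have coefES i : (i < a)%N -> E`_i.+1 = tcoef i.+1 - c * tcoef i.
  by move=> lt_i; rewrite coefB coefZ coefXM /= !coefF //; lia.
have E_le0 i : (i < a)%N -> E`_i.+1 <= 0.
  move=> lt_i; rewrite coefES // subr_le0 /c mulrAC ler_pdivlMr // ratio //.
have Ea : E`_a = 0 by rewrite coefES // /c divfK ?gt_eqF // subrr.
have EE : (E * E)`_a = 2 * ((2 * a + 3)%:R * tcoef a.+1) -
    2 * c * (2 * ((2 * a + 1)%:R * tcoef a)) + c ^+ 2 * (2 * ((2 * a - 1)%:R * tcoef a.-1)).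
  have -> : E * E = F * F - (2 * c) *: ('X * (F * F)) + c ^+ 2 *: ('X * ('X * (F * F))).
    by rewrite /E -!mul_polyC; ring.
  rewrite coefD coefB !coefZ !coefXM /= !coefFF ?leqnSn //; last by rewrite /a; lia.
  by congr (_ - _ * (_ * (_%:R * _)) + _ * (_ * (_%:R * _))); rewrite /a; lia.
have EE_ge0 : 0 <= (E * E)`_a.
  rewrite coefM big_ord_recl big_ord_recr /= /bump /= add1n subn0 subnn Ea.
  rewrite mulr0 mul0r add0r addr0 sumr_ge0 // => i _; rewrite add1n.
  have lt_i := ltn_ord i; rewrite -[(a - _)%N](@ltn_predK 0); last by rewrite /a /=; lia.
  by apply: mulr_le0; apply: E_le0; rewrite /a; lia.
move: EE_ge0; rewrite EE /a /c.
have -> : (2 * m.+2 + 3)%:R = (2 * m + 7)%:R :> rat by congr (_%:R); lia.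
have -> : (2 * m.+2 + 1)%:R = (2 * m + 7)%:R - 2 :> rat.
  by rewrite -natrB; [congr (_%:R); lia | lia].
have -> : (2 * m.+2 - 1)%:R = (2 * m + 7)%:R - 4 :> rat.
  by rewrite -natrB; [congr (_%:R); lia | lia].
have : 0 < (2 * m + 7)%:R :> rat by rewrite ltr0n; lia.
move: (_%:R) => k k0 /=; have := t0 m.+1.
move: (tcoef m.+1) (tcoef m.+2) (tcoef m.+3) => x y z x0.
(* In the coefficient of [y ^+ 2 / x] the shifts of [k] by 2 and by 4 cancel, leaving [- 2 * k]. *)
have -> : 2 * (k * z) - 2 * (y / x) * (2 * ((k - 2) * y)) + (y / x) ^+ 2 * (2 * ((k - 4) * x)) =
  2 * k / x * (x * z - y ^+ 2) by field; rewrite gt_eqF.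
by rewrite pmulr_rge0 ?subr_ge0 // divr_gt0 // mulr_gt0.
Qed.

Lemma tcoef_ratio i m : (i <= m)%N -> tcoef i.+1 * tcoef m <= tcoef m.+1 * tcoef i.
Proof. by apply: logconvex_ratio => [|k _]; [exact: tcoef_gt0 | exact: tcoef_logconvex]. Qed.

(** Log-convexity in the form used below: at a fixed sum of indices, spreading the two indices apart
    increases the product. *)
Lemma tcoef_mul_le p i j : tcoef (p + i) * tcoef (p + j) <= tcoef p * tcoef (p + i + j).
Proof.
elim: i => [|i IHi]; first by rewrite addn0.
rewrite addnS addSn; have le : (p + i <= p + i + j)%N by lia.
have := tcoef_ratio le => h.
rewrite -(ler_pM2r (tcoef_gt0 (p + i))).
apply: (@le_trans _ _ (tcoef (p + i).+1 * (tcoef p * tcoef (p + i + j)))).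
  by rewrite -mulrA (mulrC (tcoef (p + j))) ler_pM2l ?tcoef_gt0.
by rewrite mulrCA -[leRHS]mulrA ler_pM2l ?tcoef_gt0.
Qed.

Lemma tcoef_mul0_le i j : tcoef i * tcoef j <= tcoef (i + j).
Proof. by have := tcoef_mul_le 0 i j; rewrite tcoef0 mul1r. Qed.

Lemma tcoef_mul1_le i j : (0 < i)%N -> (0 < j)%N ->
  tcoef i * tcoef j <= tcoef 1 * tcoef (i + j).-1.
Proof.
case: i j => [|i] [|j] // _ _; have := tcoef_mul_le 1 i j.
by rewrite !add1n addSn addnS.
Qed.

(** This bounds the inner terms of the convolution in [tcoefS n.+1]; [bump 0 i] is the form of
    [i.+1] left by [big_ord_recl]. *)
Lemma tcoef_convol_le n :
  \sum_(i < n) tcoef (bump 0 i) * tcoef (n.+1 - bump 0 i) <= tcoef 1 * tcoef n *+ n.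
Proof.
apply: (@le_trans _ _ (\sum_(i < n) tcoef 1 * tcoef n)); last by rewrite sumr_const card_ord.
apply: ler_sum => i _; rewrite /bump /= add1n; have lt_i := ltn_ord i.
by apply: le_trans (tcoef_mul1_le _ _) _; rewrite ?subn_gt0 ?ltnS // subnKC // ltnW.
Qed.

(** Beyond the first two cases, the recurrence bounds [(2 * k + 5) * z] by [y + k * x / 12] for
    consecutive coefficients [x], [y], [z], and [x <= 5 * y] since the ratios are at least
    [tcoef 2 / tcoef 1 = 1 / 5]. *)
Lemma tcoef_ratio_le n : tcoef n.+1 <= 5 / 24 * tcoef n.
Proof.
case: n => [|[|n]]; [by rewrite tcoef0 tcoef1; lra | by rewrite tcoef1 tcoef2; lra | ].
have := tcoefS n.+2; rewrite big_ord_recl big_ord_recr /= tcoef0 subn0 subnn tcoef0.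
have -> : bump 0 n.+1 = n.+2 by [].
have := tcoef_convol_le n.+1.
have /= r1 := @tcoef_ratio 1 n.+1 isT.
move: r1; rewrite tcoef1 tcoef2 -[_ *+ n.+1]mulr_natr; move: (\sum_(i < _) _) => s.
have -> : (2 * n.+2 + 3)%:R = 2 * n.+1%:R + 5 :> rat.
  by rewrite -natrM -natrD; congr (_%:R); lia.
have k0 : 0 < n.+1%:R :> rat by rewrite ltr0n.
have := tcoef_gt0 n.+1; have := tcoef_gt0 n.+2.
move: (n.+1%:R) k0 (tcoef n.+1) (tcoef n.+2) (tcoef n.+3) => k k0 x y z y0 x0 hs hx eqz.
have hkx : 0 <= k * (5 * y - x) by rewrite mulr_ge0 //; lra.
rewrite -(ler_pM2l (_ : 0 < 2 * k + 5)); last by lra.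
by rewrite eqz; lra.
Qed.

(** The constant of [tcoef_ratio_le] fits exactly: [5 / 24 + n / 12 = (2 * n + 5) / 24]. *)
Lemma tcoef_ratio2_le n : tcoef n.+2 <= tcoef n / 24.
Proof.
have := tcoefS n.+1; rewrite big_ord_recl big_ord_recr /= tcoef0 subn0 subnn tcoef0.
have -> : bump 0 n = n.+1 by [].
have := tcoef_convol_le n.
have := tcoef_ratio_le n.
rewrite tcoef1 -[_ *+ n]mulr_natr; move: (\sum_(i < _) _) => s.
have -> : (2 * n.+1 + 3)%:R = 2 * n%:R + 5 :> rat.
  by rewrite -natrM -natrD; congr (_%:R); lia.
have k0 : 0 <= n%:R :> rat by [].
have := tcoef_gt0 n.+1; have := tcoef_gt0 n.
move: (n%:R) k0 (tcoef n) (tcoef n.+1) (tcoef n.+2) => k k0 x y z x0 y0 hs hx eqz.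
rewrite -(ler_pM2l (_ : 0 < 2 * k + 5)); last by lra.
by rewrite eqz; lra.
Qed.

(** Three consecutive blocks and the two [c]'s between them are merged into one block of the same
    degree; the 4 accounts for the factor 1/2 at each of these [c]'s. *)
Lemma tcoef_mul3_le i j k : (0 < i)%N -> (0 < j)%N -> (0 < k)%N ->
  tcoef i * tcoef j * tcoef k / 4 <= tcoef (i + j + k).+1.
Proof.
move=> i0 j0 k0.
have h1 : tcoef i * tcoef j * tcoef k <= tcoef 1 * (tcoef 1 * tcoef (i + j + k).-2).
  apply: (@le_trans _ _ (tcoef 1 * (tcoef (i + j).-1 * tcoef k))).
    by rewrite mulrA ler_pM2r ?tcoef_gt0 // tcoef_mul1_le.
  rewrite ler_pM2l ?tcoef_gt0 //; apply: le_trans (tcoef_mul1_le _ _) _; rewrite //; first by lia.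
  by rewrite (_ : ((i + j).-1 + k).-1 = (i + j + k).-2) //; lia.
have [m def_m] : exists m, (i + j + k = m.+3)%N by exists (i + j + k - 3)%N; lia.
move: h1; rewrite def_m tcoef1 /=.
(* The ratio of [tcoef m.+4] to [tcoef m.+1] is at least [tcoef 4 / tcoef 1 = 31 / 3780], which
   exceeds the required [1 / 144]. *)
have := tcoef_gt0 m.+1; have := tcoef_mul_le 1 m 3; rewrite add1n addn3 tcoef1 tcoef4 addn3.
by move=> *; lra.
Qed.

(** * Words without [cc] and the merging of their blocks *)

(* [d^a c d^(s_1) c ... c d^(s_k) c d^f] *)
Fixpoint dblocks (a : nat) (s : seq nat) (f : nat) : seq cd_letter :=
  nseq a Ld ++ Lc :: (if s is x :: s' then dblocks x s' f else nseq f Ld).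

(** In [Blocks] the outer blocks [a] and [f] may be empty, whereas an empty inner block would
    produce a [cc]. *)
Variant cc_spec (v : seq cd_letter) : Prop :=
  | HasCC u w of v = u ++ [:: Lc, Lc & w]
  | OneBlock a of v = nseq a Ld
  | Blocks a s f of all (leq 1) s & v = dblocks a s f.

Lemma ccP v : cc_spec v.
Proof.
elim: v => [|x v [u w ->|a ->|a s f s0 ->]]; first exact: (@OneBlock _ 0).
- exact: (@HasCC _ (x :: u) w).
- by case: x; [exact: (@Blocks _ 0 [::] a) | exact: (@OneBlock _ a.+1)].
- case: x; last first.
    case: s s0 => [|y s] s0; first exact: (@Blocks _ a.+1 [::] f).
    exact: (@Blocks _ a.+1 (y :: s) f).
  case: a => [|a]; last by exact: (@Blocks _ 0 (a.+1 :: s) f).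
  case: s s0 => [|y s] _; first exact: (@HasCC _ [::] (nseq f Ld)).
  exact: (@HasCC _ [::] (dblocks y s f)).
Qed.

Lemma starts_c_dblocks a s f : starts_c (dblocks a s f) = (a == 0%N).
Proof. by case: a s => [|a] []. Qed.

Lemma cd_deg_dblocks a s f :
  cd_deg (dblocks a s f) = (2 * a + 1 + 2 * f + \sum_(x <- s) (2 * x + 1))%N.
Proof.
elim: s a => [|x s IHs] a /=; rewrite cd_deg_cat cd_deg_cons ?IHs !cd_deg_nseqd.
  by rewrite big_nil; lia.
by rewrite big_cons; ring.
Qed.

Lemma nbeta_dblocks a s f : all (leq 1) s ->
  nbeta (dblocks a s f) = tcoef a * tcoef f / 2 * \prod_(x <- s) (tcoef x / 2).
Proof.
elim: s a => [|x s IHs] a /=; first by rewrite nbeta_nseqd_c ?starts_c_nseqd // big_nil mulr1.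
case/andP => x0 s0; rewrite nbeta_nseqd_c ?starts_c_dblocks -?lt0n // IHs // big_cons.
by rewrite -/(tcoef a); ring.
Qed.

(** Inner blocks are merged three into one by [tcoef_mul3_le] until a single block is left; each
    merger preserves the degree. *)
Lemma prod_tcoef_odd s : all (leq 1) s -> odd (size s) ->
  exists m, [/\ (1 <= m)%N, (\sum_(x <- s) (2 * x + 1) = 2 * m + 1)%N &
    \prod_(x <- s) (tcoef x / 2) <= tcoef m / 2].
Proof.
have [n] := ubnP (size s); elim: n => // n IHn in s *.
case: s => [|x [|y s]] //= le_n.
  by rewrite andbT => x0 _; exists x; rewrite !big_seq1.
case/and3P => x0 y0 s0; rewrite negbK => odd_s.
have [|m [m0 def_m le_m]] := IHn s _ s0 odd_s; first by lia.
exists (x + y + m).+1; split=> //; first by rewrite !big_cons def_m; lia.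
rewrite !big_cons; have := tcoef_mul3_le x0 y0 m0.
have := tcoef_gt0 x; have := tcoef_gt0 y; move: (tcoef x) (tcoef y) le_m => tx ty le_m ty0 tx0.
have : tx * ty * (\prod_(z <- s) (tcoef z / 2)) <= tx * ty * (tcoef m / 2).
  by apply: ler_wpM2l => //; rewrite ltW // mulr_gt0.
by move=> *; lra.
Qed.

(** All blocks but the first merge into one; the remaining two are then spread apart to the sizes 1
    and [m]. *)
Lemma prod_tcoef_even s : all (leq 1) s -> ~~ odd (size s) -> s != [::] ->
  exists m, [/\ (1 <= m)%N, (\sum_(x <- s) (2 * x + 1) = 2 * m + 4)%N &
    \prod_(x <- s) (tcoef x / 2) <= tcoef 1 * tcoef m / 4].
Proof.
case: s => //= x s /andP[x0 s0]; rewrite negbK => odd_s _.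
have [m [m0 def_m le_m]] := prod_tcoef_odd s0 odd_s.
exists (x + m).-1; split; first by lia.
  by rewrite big_cons def_m; lia.
rewrite big_cons; have := tcoef_mul1_le x0 m0; have := tcoef_gt0 x => tx.
have : tcoef x * \prod_(z <- s) (tcoef z / 2) <= tcoef x * (tcoef m / 2) by rewrite ler_pM2l.
by move=> *; lra.
Qed.

(** Replacing a [cc] by [d] keeps the degree, does not decrease [beta0] and shortens the word, so
    the process stops. *)
Lemma exists_ccfree v : exists2 w, cd_deg w = cd_deg v /\ (beta0 v <= beta0 w)%N &
  (exists a, w = nseq a Ld) \/ (exists a s f, all (leq 1) s /\ w = dblocks a s f).
Proof.
have [k] := ubnP (size v); elim: k => // k IHk in v * => le_k.
case: (ccP v) => [u w def_v|a def_v|a s f s0 def_v].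
- have [|w' [dw' le_w'] ccf] := IHk (u ++ Ld :: w).
    by move: le_k; rewrite def_v !size_cat /=; lia.
  exists w' => //; split.
    by rewrite dw' def_v !cd_deg_cat !cd_deg_cons.
  by apply: leq_trans le_w'; rewrite def_v beta0_cc_le.
- by exists v => //; left; exists a.
- by exists v => //; right; exists a, s, f.
Qed.

(** * Location of the maximum *)

Lemma tcoef_mul3_0_le i j k : tcoef i * tcoef j * tcoef k <= tcoef (i + j + k).
Proof.
by apply: le_trans (tcoef_mul0_le _ _); rewrite ler_pM2r ?tcoef_gt0 ?tcoef_mul0_le.
Qed.

(** The bound is the value at [c d^n c]. Even degree forces an odd number of inner blocks; these
    merge into one, which then absorbs the outer blocks. *)
Lemma nbeta_dblocks_even_le n a s f : all (leq 1) s ->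
  cd_deg (dblocks a s f) = (2 * n + 2)%N -> nbeta (dblocks a s f) <= tcoef n / 4.
Proof.
move=> s0; rewrite cd_deg_dblocks nbeta_dblocks // => def_n.
have odd_s : odd (size s).
  have : odd (\sum_(x <- s) (2 * x + 1)) = odd (size s).
    elim: (s) => [|x s' IHs]; first by rewrite big_nil.
    by rewrite big_cons /= oddD IHs oddD oddM.
  by lia.
have [m [m0 def_m le_m]] := prod_tcoef_odd s0 odd_s.
have -> : n = (a + f + m)%N by lia.
have := tcoef_mul3_0_le a f m; have := tcoef_gt0 a; have := tcoef_gt0 f => f0 a0.
have : tcoef a * tcoef f * \prod_(z <- s) (tcoef z / 2) <= tcoef a * tcoef f * (tcoef m / 2).
  by apply: ler_wpM2l => //; rewrite ltW // mulr_gt0.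
by move=> *; lra.
Qed.

(** The bound is the value at [c d c d^n c]. Odd degree forces an even number of inner blocks; if
    there is none, the word has a single [c] and [tcoef_ratio2_le] gives the bound. *)
Lemma nbeta_dblocks_odd_le n a s f : all (leq 1) s ->
  cd_deg (dblocks a s f) = (2 * n + 5)%N ->
  nbeta (dblocks a s f) <= tcoef 1 * tcoef n / 8.
Proof.
move=> s0; rewrite cd_deg_dblocks nbeta_dblocks // => def_n.
have := tcoef_gt0 a; have := tcoef_gt0 f => f0 a0.
have [s_nil|s_neq0] := eqVneq s [::].
  move: def_n; rewrite s_nil !big_nil => def_n.
  have def_af : (a + f)%N = n.+2 by lia.
  have := tcoef_mul0_le a f; have := tcoef_ratio2_le n; rewrite def_af tcoef1.
  by move=> *; lra.
have odd_s : ~~ odd (size s).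
  have : odd (\sum_(x <- s) (2 * x + 1)) = odd (size s).
    elim: (s) => [|x s' IHs]; first by rewrite big_nil.
    by rewrite big_cons /= oddD IHs oddD oddM.
  by lia.
have [m [m0 def_m le_m]] := prod_tcoef_even s0 odd_s s_neq0.
have -> : n = (a + f + m)%N by lia.
have := tcoef_mul3_0_le a f m; rewrite tcoef1 in le_m *.
have : tcoef a * tcoef f * \prod_(z <- s) (tcoef z / 2) <=
   tcoef a * tcoef f * (1 / 6 * tcoef m / 4).
  by apply: ler_wpM2l => //; rewrite ltW // mulr_gt0.
by move=> *; lra.
Qed.

Lemma nbeta_nseqd_le n a : cd_deg (nseq a Ld) = (2 * n + 2)%N ->
  nbeta (nseq a Ld) <= tcoef n / 4.
Proof.
rewrite cd_deg_nseqd => def_a; have -> : a = n.+1 by lia.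
by have := tcoef_ratio_le n; have := tcoef_gt0 n; rewrite -/(tcoef _) => *; lra.
Qed.

Lemma nbeta_le v w : cd_deg v = cd_deg w -> (nbeta v <= nbeta w) = (beta0 v <= beta0 w)%N.
Proof.
by move=> dv; rewrite /nbeta dv ler_pM2r ?invr_gt0 ?factr_gt0 // ler_nat.
Qed.

Lemma beta0_even_max n v : (1 <= n)%N -> cd_deg v = (2 * n + 2)%N ->
  (beta0 v <= beta0 ([:: Lc] ++ nseq n Ld ++ [:: Lc]))%N.
Proof.
move=> n1 dv; have [w [dw le_w] ccf] := exists_ccfree v.
apply: leq_trans le_w _; set m := _ ++ _.
have def_m : m = dblocks 0 [:: n] 0 by [].
have dm : cd_deg m = cd_deg v by rewrite def_m cd_deg_dblocks big_seq1; lia.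
rewrite -nbeta_le ?dw // def_m nbeta_dblocks /= ?n1 // big_seq1 tcoef0.
rewrite [leRHS](_ : _ = tcoef n / 4); last by field.
by case: ccf => [[a def_w]|[a [s [f [s0 def_w]]]]]; rewrite def_w;
  [apply: nbeta_nseqd_le | apply: nbeta_dblocks_even_le]; rewrite // -def_w dw.
Qed.

Lemma beta0_odd_max n v : (1 <= n)%N -> cd_deg v = (2 * n + 5)%N ->
  (beta0 v <= beta0 ([:: Lc; Ld; Lc] ++ nseq n Ld ++ [:: Lc]))%N /\
  (beta0 v <= beta0 ([:: Lc] ++ nseq n Ld ++ [:: Lc; Ld; Lc]))%N.
Proof.
move=> n1 dv; have [w [dw le_w] ccf] := exists_ccfree v.
have le_n : nbeta w <= tcoef 1 * tcoef n / 8.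
  case: ccf => [[a def_w]|[a [s [f [s0 def_w]]]]].
    by have := dv; rewrite -dw def_w cd_deg_nseqd; lia.
  by rewrite def_w; apply: nbeta_dblocks_odd_le; rewrite // -def_w dw.
(* Both claimed words have inner blocks of sizes 1 and [n], in either order, and the product formula
   ignores the order. *)
have max m s : m = dblocks 0 s 0 -> perm_eq s [:: 1; n]%N -> (beta0 v <= beta0 m)%N.
  move=> -> perm_s; apply: leq_trans le_w _.
  have s0 : all (leq 1) s by rewrite (perm_all _ perm_s) /= n1.
  rewrite -nbeta_le; last first.
    by rewrite cd_deg_dblocks (perm_big _ perm_s) /= !big_cons big_nil; lia.
  apply: le_trans le_n _; rewrite nbeta_dblocks // (perm_big _ perm_s) /= !big_cons big_nil.
  by rewrite tcoef0 le_eqVlt; apply/orP; left; apply/eqP; field.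
split; first exact: (max _ [:: 1; n]%N).
by apply: (max _ [:: n; 1]%N) => //; rewrite (perm_catC [:: n] [:: 1%N]).
Qed.

(** * Expansion of cd-words *)

(* Words in [a] and [b] are encoded by booleans, with [true] for [b]; [expands p w]
   says that [p] occurs in the expansion of [w] under [c |-> a + b],
   [d |-> ab + ba]. *)
Fixpoint expands (p : seq bool) (w : seq cd_letter) : bool :=
  match w, p with
  | [::], [::] => true
  | Lc :: w', _ :: p' => expands p' w'
  | Ld :: w', x :: y :: p' => (x != y) && expands p' w'
  | _, _ => false
  end.

Definition ab_monom (p : seq bool) : {fmonom ab_letter} := FMonom (map ab_of_bool p).

Lemma ab_monomP (m : {fmonom ab_letter}) : exists p, m = ab_monom p.
Proof.
case: m => s; exists (map ab_to_bool s).
by rewrite /ab_monom -map_comp map_id_in // => x _; exact: ab_to_boolK.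
Qed.

Lemma mcoeff_letterM (x : bool) (g : ab_poly) p :
  (<< FMonom [:: ab_of_bool x] >> * g)@_(ab_monom p) =
  if p is y :: p' then (x == y)%:R * g@_(ab_monom p') else 0.
Proof.
rewrite {1}[g]monalgE mulr_sumr raddf_sum /=.
transitivity (\sum_(k <- msupp g) g@_k *+ (FMonom (ab_of_bool x :: k) == ab_monom p)).
  apply: eq_bigr => k _; rewrite malgM_def fgmulUU mcoeffU mul1r; congr (_ *+ (_ == _)).
  by apply/eqP; rewrite fmP fmM.
case: p => [|y p]; first by rewrite big1.
have [<-|xy] := eqVneq x y; last first.
  rewrite mul0r big1 // => k _; rewrite (_ : (_ == _) = false) //.
  by apply/negbTE; apply: contra xy => /eqP[]; case: x; case: y.
rewrite mul1r {3}[g]monalgE raddf_sum /=; apply: eq_bigr => k _.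
rewrite mcoeffU; congr (_ *+ nat_of_bool _); rewrite !fmP /=.
by rewrite eqseq_cons eqxx.
Qed.

Lemma mcoeff_vaM (g : ab_poly) p :
  (va * g)@_(ab_monom p) = if p is false :: p' then g@_(ab_monom p') else 0.
Proof.
by rewrite (mcoeff_letterM false); case: p => [|[] p] //; rewrite ?mul0r ?mul1r.
Qed.

Lemma mcoeff_vbM (g : ab_poly) p :
  (vb * g)@_(ab_monom p) = if p is true :: p' then g@_(ab_monom p') else 0.
Proof.
by rewrite (mcoeff_letterM true); case: p => [|[] p] //; rewrite ?mul0r ?mul1r.
Qed.

Lemma cd_subst_word_c w : cd_subst_word (FMonom (Lc :: w)) =
  va * cd_subst_word (FMonom w) + vb * cd_subst_word (FMonom w).
Proof. by rewrite /cd_subst_word big_cons -[RHS]mulrDl. Qed.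

Lemma cd_subst_word_d w : cd_subst_word (FMonom (Ld :: w)) =
  va * (vb * cd_subst_word (FMonom w)) + vb * (va * cd_subst_word (FMonom w)).
Proof.
have distr (R : pzRingType) (a b g : R) : (a * b + b * a) * g = a * (b * g) + b * (a * g).
  by rewrite mulrDl !mulrA.
by rewrite /cd_subst_word big_cons; apply: distr.
Qed.

Lemma mcoeff_vaM_vbM (g h : ab_poly) p :
  (va * g + vb * h)@_(ab_monom p) =
  if p is x :: p' then (if x then h else g)@_(ab_monom p') else 0.
Proof.
rewrite mcoeffD [X in X + _]mcoeff_vaM [X in _ + X]mcoeff_vbM.
by case: p => [|[] p]; rewrite ?addr0 ?add0r.
Qed.

Lemma mcoeff_cd_subst_word w p :
  (cd_subst_word (FMonom w))@_(ab_monom p) = (expands p w)%:R.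
Proof.
elim: w p => [|[] w IHw] p.
- rewrite /cd_subst_word big_nil mcoeff1 [_ == _](_ : _ = (p == [::])); first by case: p.
  by rewrite fmP fm1; case: p.
- by rewrite cd_subst_word_c mcoeff_vaM_vbM; case: p => [|[] p] //=; rewrite IHw.
- rewrite cd_subst_word_d mcoeff_vaM_vbM; case: p => [|[] p] //.
    by rewrite [LHS]mcoeff_vaM; case: p => [|[] p] //=; rewrite IHw.
  by rewrite [LHS]mcoeff_vbM; case: p => [|[] p] //=; rewrite IHw.
Qed.

Lemma mcoeff_cd_subst X p :
  (cd_subst X)@_(ab_monom p) = \sum_(k <- msupp X) X@_k * (expands p k)%:R.
Proof.
rewrite /cd_subst /mmap raddf_sum /=; apply: eq_bigr => k _.
by rewrite mulrzl raddfMz /= -[k in cd_subst_word k]fmK mcoeff_cd_subst_word mulrzz mulrC.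
Qed.

(** Here [u] is a literal prefix of [w] and [p] occurs in the expansion of the rest. This
    interpolates between [expands] ([u] empty) and equality of words ([p] empty). *)
Fixpoint expands_after (u : seq cd_letter) (p : seq bool) (w : seq cd_letter) : bool :=
  match u, w with
  | [::], _ => expands p w
  | x :: u', y :: w' => (x == y) && expands_after u' p w'
  | _, [::] => false
  end.

Lemma expands_after_nil u w : expands_after u [::] w = (w == u).
Proof.
elim: u w => [|x u IHu] [|y w] //=; first by case: y.
by rewrite IHu eqseq_cons eq_sym.
Qed.

Lemma expands_after1 u x w :
  expands_after u [:: x] w = expands_after (rcons u Lc) [::] w.
Proof.
elim: u w => [|z u IHu] [|y w] //=; last by rewrite IHu.
by case: y => //=; case: w.
Qed.

Lemma expands_after2 u x y p w :
  (expands_after u [:: x, y & p] w =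
   expands_after (rcons u Lc) (y :: p) w + (x != y) * expands_after (rcons u Ld) p w :> nat)%N.
Proof.
elim: u w => [|z u IHu] [|z' w] //=; rewrite ?muln0 //.
  by case: z' => /=; rewrite ?muln0 ?addn0 // add0n mulnb.
by case: (z == z'); rewrite ?IHu ?muln0.
Qed.

(* The sums of the coefficients of [u w] over the [w] expanding to [p] vanish for
   all [p]: from [u] this passes to [u c] on words starting with a repeated letter,
   and then to [u d]. *)
Lemma cd_subst_inj : injective cd_subst.
Proof.
have cd_subst0 X : cd_subst X = 0 -> X = 0.
  move=> X0; pose f u p := \sum_(k <- msupp X) X@_k * (expands_after u p k)%:R.
  have f0 u p : f u p = 0.
    elim/last_ind: u p => [|u x IHu] p; first by rewrite /f -mcoeff_cd_subst X0 mcoeff0.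
    have f2 y z q : f u [:: y, z & q] = f (rcons u Lc) (z :: q) + (y != z)%:R * f (rcons u Ld) q.
      rewrite /f big_distrr -big_split /=; apply: eq_bigr => k _.
      by rewrite expands_after2 natrD natrM mulrDr mulrCA.
    have fc q : f (rcons u Lc) q = 0.
      case: q => [|z q].
        rewrite -(IHu [:: true]); apply: eq_bigr => k _; by rewrite expands_after1.
      by have := f2 z z q; rewrite eqxx mul0r addr0 IHu.
    case: x => //; have := f2 true false p; by rewrite fc add0r mul1r IHu.
  apply/malgP => k; rewrite mcoeff0; have := f0 k [::]; rewrite /f.
  rewrite (eq_bigr (fun k' => << X@_k' *g k' >>@_k)); last first.
    by move=> k' _; rewrite mcoeffU expands_after_nil -fmP mulr_natr.
  by rewrite -raddf_sum /= -monalgE.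
move=> X Y eqXY; apply/eqP; rewrite -subr_eq0; apply/eqP; apply: cd_subst0.
by rewrite /cd_subst mmapB; apply/eqP; rewrite subr_eq0; apply/eqP.
Qed.

(** * Enumeration of cd-words and of those expanding to a given ab-word *)

Fixpoint cd_words r : seq (seq cd_letter) :=
  if r is r'.+1 then
    map (cons Lc) (cd_words r') ++
    (if r' is r''.+1 then map (cons Ld) (cd_words r'') else [::])
  else [:: [::]].

(** These are the words [w] with [expands p w], as [big_cd_words_expands] makes precise. *)
Fixpoint expanders (p : seq bool) : seq (seq cd_letter) :=
  if p is x :: p' then
    map (cons Lc) (expanders p') ++
    (if p' is y :: p'' then
       if x != y then map (cons Ld) (expanders p'') else [::] else [::])
  else [:: [::]].

Lemma big_cd_words_1 (K : seq cd_letter -> int) w :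
  \sum_(w' <- cd_words (cd_deg w)) K w' *+ (w' == w) = K w.
Proof.
elim: w K => [|x w IHw] K; first by rewrite cd_deg_nil big_seq1.
rewrite cd_deg_cons; case: x; rewrite ?add1n ?add2n /= big_cat big_map.
  rewrite (eq_bigr (fun w' => (K \o cons Lc) w' *+ (w' == w))); last first.
    by move=> w' _; rewrite eqseq_cons eqxx.
  rewrite IHw /= big1_seq ?addr0 // => w' /andP[_].
  by case: (cd_deg w) => //= n /mapP[? _ ->].
rewrite big1 // big_map -[RHS](IHw (K \o cons Ld)) [LHS]add0r.
by apply: eq_bigr => w' _; rewrite eqseq_cons eqxx.
Qed.

Lemma big_cd_words_expands (K : seq cd_letter -> nat) r p :
  (\sum_(w <- cd_words r) K w * expands p w =
   if size p == r then \sum_(w <- expanders p) K w else 0)%N.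
Proof.
have [n] := ubnP (size p); elim: n => // n IHn in K r p *.
case: p r => [|x p] [|r]; rewrite ?big_seq1 ?muln1 ?muln0 //.
  move=> _; rewrite big1_seq // => w /andP[_]; rewrite /= mem_cat => /orP[/mapP[? _ ->]|].
    by rewrite /= muln0.
  by case: r => [|r] // /mapP[? _ ->]; rewrite /= muln0.
rewrite ltnS => le_n; rewrite /= !big_cat !big_map /= eqSS.
rewrite (IHn (K \o cons Lc)) //.
pose dpart := if p is y :: p' then
  if x != y then map (cons Ld) (expanders p') else [::] else [::].
transitivity ((if size p == r then \sum_(w <- expanders p) K (Lc :: w) else 0) +
  (if size p == r then \sum_(w <- dpart) K w else 0))%N; last by case: ifP.
rewrite /dpart {dpart}; congr (_ + _)%N.
case: p r le_n => [|y p] [|r] le_n; rewrite ?big_nil // big_map /=.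
  by rewrite big1 // => ? _; rewrite muln0.
have := IHn (K \o cons Ld) r p; rewrite eqSS; case: (x == y) => /= IH.
  by rewrite big_nil big1 => [|? _]; rewrite ?muln0 //; case: ifP.
by rewrite big_map -IH //; apply: ltnW.
Qed.

Lemma big_expanders_cons (K : seq cd_letter -> nat) x y p :
  (\sum_(w <- expanders [:: x, y & p]) K w =
   \sum_(w <- expanders (y :: p)) K (Lc :: w) +
   (if x != y then \sum_(w <- expanders p) K (Ld :: w) else 0))%N.
Proof. by rewrite [expanders (x :: _)]/= big_cat big_map; case: ifP; rewrite ?big_map ?big_nil. Qed.

Lemma expanders_neq0 x p w : w \in expanders (x :: p) -> w != [::].
Proof.
rewrite /= mem_cat => /orP[/mapP[? _ -> //]|].
by case: p => [|y p] //; case: ifP => // _ /mapP[? _ ->].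
Qed.

Lemma big_expanders_c (K : seq cd_letter -> nat) x p :
  (\sum_(w <- expanders (x :: p)) (if w is Lc :: w' then K w' else 0) =
   \sum_(w <- expanders p) K w)%N.
Proof.
rewrite [expanders (x :: p)]/= big_cat big_map /= [X in (_ + X)%N]big1_seq ?addn0 // => w /andP[_].
by case: p => [|y p] //; case: ifP => // _ /mapP[? _ ->].
Qed.

Lemma expanders_deg p w : w \in expanders p -> cd_deg w = size p.
Proof.
have [n] := ubnP (size p); elim: n => // n IHn in p w *.
case: p => [|x p] /= le_n; first by rewrite inE => /eqP->; rewrite cd_deg_nil.
rewrite mem_cat => /orP[/mapP[w' /IHn dw ->]|]; first by rewrite cd_deg_cons dw.
case: p le_n => [|y p] //= le_n; case: ifP => // _ /mapP[w' /IHn dw ->].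
by rewrite cd_deg_cons dw //; apply: ltnW.
Qed.

Lemma expanders_nseq0 r : expanders (nseq r false) = [:: nseq r Lc].
Proof. by elim: r => [|r IHr] //=; rewrite IHr; case: (r). Qed.

Arguments expanders : simpl never.

(** A [c] at the inserted position accepts both letters, hence the two copies of [u c v] in [glue];
    a [d] covering this position and a neighbouring letter accepts exactly one of them. *)
Lemma big_expanders_glue (K : seq cd_letter -> nat) u v :
  (\sum_(w <- expanders (u ++ false :: v)) K w + \sum_(w <- expanders (u ++ true :: v)) K w =
   \sum_(w1 <- expanders u) \sum_(w2 <- expanders v) \sum_(w <- glue w1 w2) K w)%N.
Proof.
have base K' : (\sum_(w <- expanders (false :: v)) K' w + \sum_(w <- expanders (true :: v)) K' w =
   \sum_(w2 <- expanders v) \sum_(w <- glue [::] w2) K' w)%N.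
  rewrite (eq_bigr _ (fun w2 _ => big_glue0 K' w2)) big_split -big_distrr /=.
  case: v => [|y v]; first by rewrite !big_seq1; lia.
  rewrite (big_expanders_c (fun w => K' (Ld :: w)) y v) !big_expanders_cons.
  by case: y => /=; ring.
have [n] := ubnP (size u); elim: n => // n IHn in K u *.
case: u => [|x [|y u]] le_n; first by rewrite big_seq1; exact: base.
  rewrite big_seq1 (eq_bigr _ (fun w2 _ => big_glue1 K w2)) big_split /= -base.
  by rewrite !big_expanders_cons; case: (x) => /=; ring.
rewrite !cat_cons !big_expanders_cons.
have lt_n : (size (y :: u) < n)%N by [].
have := IHn (K \o cons Lc) (y :: u) lt_n; have := IHn (K \o cons Ld) u (ltnW lt_n).
rewrite !cat_cons /= => IHd IHc.
have -> : (\sum_(w1 <- expanders (y :: u)) \sum_(w2 <- expanders v)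
    \sum_(w <- glue (Lc :: w1) w2) K w =
  \sum_(w1 <- expanders (y :: u)) \sum_(w2 <- expanders v)
    \sum_(w <- glue w1 w2) K (Lc :: w))%N.
  apply: eq_big_seq => w1 /expanders_neq0 nw1.
  by apply: eq_bigr => w2 _; rewrite big_glue_c.
have -> : (\sum_(w1 <- expanders u) \sum_(w2 <- expanders v)
    \sum_(w <- glue (Ld :: w1) w2) K w =
  \sum_(w1 <- expanders u) \sum_(w2 <- expanders v)
    \sum_(w <- glue w1 w2) K (Ld :: w))%N.
  by apply: eq_bigr => w1 _; apply: eq_bigr => w2 _; rewrite big_glue_d.
by rewrite -IHc -IHd; case: ifP => _; ring.
Qed.

(** * Flag vectors read off from the recursive coefficients *)

Definition hvec p : nat := (\sum_(w <- expanders p) beta0 w)%N.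

Lemma hvec_mul u v :
  (hvec (u ++ false :: v) + hvec (u ++ true :: v) =
   'C(size u + size v + 2, (size u).+1) * (hvec u * hvec v))%N.
Proof.
rewrite /hvec big_expanders_glue big_distrl big_distrr /=.
apply: eq_big_seq => w1 /expanders_deg d1; rewrite !big_distrr /=.
by apply: eq_big_seq => w2 /expanders_deg d2; rewrite beta0_mul d1 d2.
Qed.

Lemma beta0_nseqc r : beta0 (nseq r Lc) = 1%N.
Proof.
elim: r => [|r IHr]; first exact: beta0_nil.
rewrite beta0E // (_ : lower _ = [:: nseq r Lc]) ?big_seq1 //.
have lower_cc v : lower (Lc :: Lc :: v) = map (cons Lc) (lower (Lc :: v)) by exact: cats0.
by elim: r {IHr} => [|r] //= IHr; rewrite lower_cc IHr.
Qed.

Lemma hvec_nseq0 r : hvec (nseq r false) = 1%N.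
Proof.
by rewrite /hvec expanders_nseq0 big_seq1 beta0_nseqc.
Qed.

(** With [p] read as the indicator of a set, these are the indicators of its subsets. *)
Fixpoint belows (p : seq bool) : seq (seq bool) :=
  match p with
  | [::] => [:: [::]]
  | false :: p' => map (cons false) (belows p')
  | true :: p' => map (cons false) (belows p') ++ map (cons true) (belows p')
  end.

(** Summing over subsets inverts the inclusion-exclusion that defines [flag_h] from [flag_f]. *)
Definition fvec p : nat := (\sum_(q <- belows p) hvec q)%N.

Lemma size_belows p q : q \in belows p -> size q = size p.
Proof.
elim: p q => [|[] p IHp] q /=; first by rewrite inE => /eqP->.
  by rewrite mem_cat => /orP[] /mapP[q' /IHp <- ->].
by move=> /mapP[q' /IHp <- ->].
Qed.

Lemma big_belows_cat (K : seq bool -> nat) u v :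
  (\sum_(q <- belows (u ++ true :: v)) K q =
   \sum_(q1 <- belows u) \sum_(q2 <- belows v) (K (q1 ++ false :: q2) + K (q1 ++ true :: q2)))%N.
Proof.
elim: u K => [|x u IHu] K; first by rewrite big_seq1 /= big_cat !big_map big_split.
by case: x; rewrite /= ?big_cat !big_map !(IHu (K \o cons _)).
Qed.

(** The two terms of [hvec_mul] are the two choices of a subset at the middle position. The binomial
    counts the possible members of cardinal [(size u).+1] of a chain in a set with
    [size u + size v + 2] elements. *)
Lemma fvec_mul u v :
  (fvec (u ++ true :: v) = 'C(size u + size v + 2, (size u).+1) * (fvec u * fvec v))%N.
Proof.
rewrite /fvec big_belows_cat big_distrl big_distrr /=.
apply: eq_big_seq => w1 /size_belows d1; rewrite !big_distrr /=.
by apply: eq_big_seq => w2 /size_belows d2; rewrite hvec_mul d1 d2.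
Qed.

Lemma fvec_nseq0 r : fvec (nseq r false) = 1%N.
Proof.
rewrite /fvec (_ : belows _ = [:: nseq r false]) ?big_seq1 ?hvec_nseq0 //.
by elim: r => [|r IHr] //=; rewrite IHr.
Qed.

(** * The flag vectors of the Boolean lattice *)

Definition set_chain (T : finType) (C : {set {set T}}) : bool :=
  [forall x in C, forall y in C, (x \subset y) || (y \subset x)].

Lemma set_chainP (T : finType) (C : {set {set T}}) :
  reflect {in C &, forall x y : {set T}, (x \subset y) || (y \subset x)} (set_chain C).
Proof.
apply: (iffP forall_inP) => [h x y xC yC|h x xC].
  by move/forall_inP: (h x xC); apply.
by apply/forall_inP => y yC; apply: h.
Qed.

Lemma set_chain_inj (T : finType) (C : {set {set T}}) : set_chain C ->
  {in C &, injective (fun x : {set T} => #|x|)}.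
Proof.
move/set_chainP => chC x y xC yC /= eq_xy.
have /orP[sub|sub] := chC x y xC yC; apply/eqP; first by rewrite eqEcard sub eq_xy leqnn.
by rewrite eq_sym eqEcard sub eq_xy leqnn.
Qed.

Lemma is_chainE n (C : {set boolean_lattice n}) : is_chain C = set_chain (C : {set {set 'I_n}}).
Proof. by []. Qed.

Lemma lattice_ltE n (x y : boolean_lattice n) : (x < y)%O = ((x : {set 'I_n}) \proper y).
Proof. by rewrite lt_neqAle properEneq. Qed.

Lemma card_chain_lt (T : finType) (C : {set {set T}}) m : set_chain C ->
  {in C, forall x : {set T}, (#|x| < m)%N} -> (#|C| <= m)%N.
Proof.
move=> chC ltC; case: (posnP #|C|) => [-> //|/card_gt0P[x0 x0C]].
have m0 : (0 < m)%N by apply: leq_ltn_trans (ltC _ x0C).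
pose f (x : {set T}) : 'I_m := insubd (Ordinal m0) #|x|.
rewrite -(card_in_imset (f := f)) => [|x y xC yC /(congr1 val)].
  by rewrite -[X in (_ <= X)%N]card_ord max_card.
by rewrite /f !val_insubd !ltC // => /(set_chain_inj chC xC yC).
Qed.

Lemma set_chain_exists (T : finType) (x : {set T}) :
  exists2 C : {set {set T}}, set_chain C && [forall y in C, y \proper x] & #|C| = #|x|.
Proof.
have [n] := ubnP #|x|; elim: n => // n IHn in x *.
case: (set_0Vmem x) => [->|[a ax]] le_n.
  exists set0; rewrite ?cards0 //; apply/andP; split.
    by apply/set_chainP => y z; rewrite inE.
  by apply/forall_inP => y; rewrite inE.
have [|C /andP[/set_chainP chC /forall_inP ltC] cardC] := IHn (x :\ a).
  by move: le_n; rewrite (cardsD1 a x) ax.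
have prop_xa : x :\ a \proper x by rewrite properD1.
exists (x :\ a |: C).
  apply/andP; split.
    apply/set_chainP => y z; rewrite !inE => /orP[/eqP->|yC] /orP[/eqP->|zC].
    - by rewrite subxx.
    - by rewrite (proper_sub (ltC _ zC)) orbT.
    - by rewrite (proper_sub (ltC _ yC)).
    - exact: chC.
  apply/forall_inP => y; rewrite !inE => /orP[/eqP-> //|yC].
  by apply: proper_trans prop_xa; apply: ltC.
rewrite cardsU1 cardC (cardsD1 a x) ax; congr (nat_of_bool _ + _)%N.
by apply/negP => /ltC; rewrite properxx.
Qed.

Lemma poset_rank_lattice n (x : boolean_lattice n) : poset_rank x = #|(x : {set 'I_n})|.
Proof.
apply/eqP; rewrite eqn_leq; apply/andP; split.
  apply/bigmax_leqP => C /andP[chC /forall_inP ltC].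
  apply: card_chain_lt => [|y yC]; first by rewrite -is_chainE.
  by apply: proper_card; rewrite -lattice_ltE; apply: ltC.
have [C /andP[chC /forall_inP ltC] <-] := @set_chain_exists 'I_n x.
apply: (bigop.bigmax_sup (C : {set boolean_lattice n})) => //.
rewrite is_chainE chC /=; apply/forall_inP => y yC.
by rewrite lattice_ltE; apply: ltC.
Qed.

Lemma inner_rank_lattice n : inner_rank (boolean_lattice n) = n.-1.
Proof.
rewrite /inner_rank poset_rank_lattice Order.SetSubsetOrder.topEsubset.
by rewrite cardsT card_ord.
Qed.

(* The chains of nonempty subsets of [Y] whose set of cardinals is
   [{k.+1 | nth false p k}]. *)
Definition ranked_chain (T : finType) (Y : {set T}) (p : seq bool) (C : {set {set T}}) :=
  [&& set_chain C,
      [forall x in C, [&& x \subset Y, (0 < #|x|)%N & nth false p #|x|.-1]]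
    & all (fun k => nth false p k ==> [exists x in C, #|x| == k.+1]) (iota 0 (size p))].

Lemma ranked_chainP (T : finType) (Y : {set T}) (p : seq bool) (C : {set {set T}}) :
  reflect [/\ set_chain C,
      {in C, forall x : {set T}, [/\ x \subset Y, 0 < #|x| & nth false p #|x|.-1]}%N
    & forall k, nth false p k -> exists2 x, x \in C & #|x| = k.+1] (ranked_chain Y p C).
Proof.
apply: (iffP and3P) => [[chC /forall_inP inC /allP exC]|[chC inC exC]]; split=> //.
- by move=> x /inC/and3P.
- move=> k pk; have /implyP/(_ pk) : nth false p k ==> [exists x in C, #|x| == k.+1].
    apply: exC; rewrite mem_iota /= add0n ltnNge; apply: contraTN pk => le_k.
    by rewrite nth_default.
  by case/exists_inP => x xC /eqP; exists x.
- by apply/forall_inP => x /inC/and3P.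
- apply/allP => k _; apply/implyP => /exC[x xC xk].
  by apply/exists_inP; exists x; rewrite ?xk.
Qed.

Lemma ranked_chain_rcons0 (T : finType) (Y : {set T}) p C :
  ranked_chain Y (rcons p false) C = ranked_chain Y p C.
Proof.
have nthE k : nth false (rcons p false) k = nth false p k.
  rewrite nth_rcons; case: ltngtP => // [lt|->]; rewrite nth_default //.
  exact: ltnW.
apply/ranked_chainP/ranked_chainP => -[chC inC exC]; split=> // [x xC|k pk].
- by have := inC x xC; rewrite nthE.
- by apply: exC; rewrite nthE.
- by have := inC x xC; rewrite nthE.
- by apply: exC; rewrite -nthE.
Qed.

(** As [Z] has the largest cardinal that [rcons p true] allows, the other members of a chain through
    [Z] lie strictly below it and have the cardinals given by [p]. *)
Lemma ranked_chain_rcons1 (T : finType) (Y Z : {set T}) p :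
  Z \subset Y -> #|Z| = (size p).+1 ->
  [set C | ranked_chain Y (rcons p true) C & Z \in C] =
  [set Z |: C | C in [set C | ranked_chain Z p C]].
Proof.
move=> sZY cZ; have nthp : nth false (rcons p true) (size p).
  by rewrite nth_rcons ltnn eqxx.
have ltp k : nth false p k -> (k < size p)%N.
  by rewrite ltnNge; apply: contraTN => le_k; rewrite nth_default.
apply/setP => C; rewrite inE; apply/andP/imsetP => [[/ranked_chainP[chC inC exC] ZC]|].
  have chD : set_chain (C :\ Z).
    apply/set_chainP => x y; rewrite !inE => /andP[_ xC] /andP[_ yC].
    by move/set_chainP: chC; apply.
  exists (C :\ Z); last by rewrite setD1K.
  rewrite inE; apply/ranked_chainP; split=> // [x|k pk].
    rewrite !inE => /andP[xZ xC]; have [sxY x0] := inC x xC.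
    have nx : #|x| != #|Z| by apply: contra xZ => /eqP/(set_chain_inj chC xC ZC) ->.
    rewrite nth_rcons; case: ltngtP => [lt_x px|//|eq_x]; last first.
      by case/eqP: nx; rewrite cZ -eq_x prednK.
    split=> //; have /set_chainP/(_ x Z xC ZC)/orP[//|sZx] := chC.
    by have := subset_leq_card sZx; rewrite cZ; lia.
  have [|x xC xk] := exC k; first by rewrite nth_rcons (ltp _ pk).
  exists x => //; rewrite !inE xC andbT; apply/eqP => eq_x.
  by have := ltp _ pk; move: xk; rewrite eq_x cZ => -[->]; rewrite ltnn.
case=> D; rewrite inE => /ranked_chainP[chD inD exD] ->; split; last by rewrite setU11.
apply/ranked_chainP; split=> [|x|k].
- apply/set_chainP => x y; rewrite !inE => /orP[/eqP->|xD] /orP[/eqP->|yD].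
  + by rewrite subxx.
  + by have [-> _ _] := inD y yD; rewrite orbT.
  + by have [-> _ _] := inD x xD.
  + by move/set_chainP: chD; apply.
- rewrite !inE => /orP[/eqP->|xD]; first by rewrite cZ /= nthp.
  have [sxZ x0 px] := inD x xD; rewrite x0 nth_rcons (ltp _ px); split=> //.
  exact: subset_trans sZY.
- rewrite nth_rcons; case: ltngtP => // [_ /exD[x xD xk]|-> _].
    by exists x; rewrite // !inE xD orbT.
  by exists Z; rewrite ?setU11.
Qed.

(** Induction from the top rank down: a final [false] joins the padding of length [i], while a final
    [true] means choosing the largest member [Z] and then a chain inside [Z], as in [fvec_mul]. *)
Lemma card_ranked_chain (T : finType) (Y : {set T}) p i : #|Y| = (size p + i).+1 ->
  #|[set C | ranked_chain Y p C]| = fvec (p ++ nseq i false).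
Proof.
elim/last_ind: p Y i => [|p [] IHp] Y i; last 1 first.
- rewrite size_rcons addSnnS => cY; rewrite cat_rcons -(IHp Y i.+1 cY).
  by apply: eq_card => C; rewrite !inE ranked_chain_rcons0.
- move=> _; rewrite fvec_nseq0 (_ : [set _ | _] = [set set0]) ?cards1 //.
  apply/setP => C; rewrite !inE; apply/ranked_chainP/eqP => [[_ inC _]|->].
    apply/setP => x; rewrite inE; apply/negP => /inC[_ _]; by rewrite nth_nil.
  split=> [|x|k]; rewrite ?inE ?nth_nil //.
  by apply/set_chainP => x y; rewrite inE.
rewrite size_rcons => cY; rewrite cat_rcons fvec_mul size_nseq fvec_nseq0 muln1.
(* The default [set0] is never reached on the chains counted, which all have a member of this
   cardinal. *)
pose top (C : {set {set T}}) : {set T} := odflt set0 [pick x in C | #|x| == (size p).+1].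
have topP C : ranked_chain Y (rcons p true) C -> forall Z : {set T},
    (top C == Z) = (Z \in C) && (#|Z| == (size p).+1).
  case/ranked_chainP => chC inC exC Z; rewrite /top; case: pickP => [x /andP[xC /eqP cx]|none] /=.
    apply/eqP/andP => [<-|[ZC /eqP cZ]]; first by rewrite xC cx.
    by apply: (set_chain_inj chC) => //=; rewrite cx cZ.
  have [|x xC cx] := exC (size p); first by rewrite nth_rcons ltnn eqxx.
  by have := none x; rewrite xC cx eqxx.
rewrite -sum1_card (partition_big top
   (fun Z : {set T} => (Z \subset Y) && (#|Z| == (size p).+1))) /=; last first.
  move=> C; rewrite inE => rC; have := topP C rC (top C); rewrite eqxx => /esym/andP[tC ->].
  by case/ranked_chainP: rC => _ /(_ _ tC)[-> _ _].
rewrite (eq_bigr (fun _ => fvec p)) => [|Z /andP[sZY /eqP cZ]].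
  rewrite sum_nat_const mulnC [in RHS]mulnC; congr (_ * _)%N.
  rewrite -[LHS]cardsE cards_draws cY; congr 'C(_, _); lia.
rewrite -[p in RHS]cats0 -(IHp Z 0%N) ?addn0 //.
have inj_U : {in [set C | ranked_chain Z p C] &, injective (fun C => Z |: C)}.
  have nZ (C : {set {set T}}) : C \in [set C | ranked_chain Z p C] -> Z \notin C.
    rewrite inE => /ranked_chainP[_ inC _]; apply/negP => /inC[_ _].
    by rewrite cZ /= nth_default.
  by move=> C D /nZ nC /nZ nD /= /(congr1 (fun E => E :\ Z)); rewrite !setU1K.
rewrite -(card_in_imset inj_U) -(ranked_chain_rcons1 sZY cZ) sum1dep_card.
apply: eq_card => C; rewrite !inE; case: (boolP (ranked_chain _ _ _)) => //= rC.
by rewrite topP // cZ eqxx andbT.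
Qed.

(** * Rank sets as words, and inclusion-exclusion *)

Definition set_word r (S : {set 'I_r}) : seq bool := [seq i \in S | i <- enum 'I_r].

Lemma size_set_word r (S : {set 'I_r}) : size (set_word S) = r.
Proof. by rewrite size_map size_enum_ord. Qed.

Lemma nth_set_word r (S : {set 'I_r}) (i : 'I_r) : nth false (set_word S) i = (i \in S).
Proof. by rewrite (nth_map i) ?size_enum_ord // nth_ord_enum. Qed.

Lemma set_word_inj r : injective (@set_word r).
Proof. by move=> S U eqSU; apply/setP => i; rewrite -!nth_set_word eqSU. Qed.

Lemma set_wordK r p : size p = r -> set_word [set i : 'I_r | nth false p i] = p.
Proof.
move=> size_p; apply: (@eq_from_nth _ false); rewrite size_set_word // => i lt_i.
by rewrite (nth_set_word _ (Ordinal lt_i)) inE.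
Qed.

Lemma flag_f_lattice r (S : {set 'I_(inner_rank (boolean_lattice r.+1))}) :
  flag_f S = fvec (set_word S).
Proof.
have rE := inner_rank_lattice r.+1; rewrite /= in rE.
rewrite -[set_word S]cats0 -(@card_ranked_chain 'I_r.+1 setT _ 0); last first.
  by rewrite size_set_word rE cardsT card_ord addn0.
apply: eq_card => C; rewrite !inE is_chainE.
rewrite Order.SetSubsetOrder.topEsubset Order.SetSubsetOrder.botEsubset.
apply/and4P/ranked_chainP => [[chC n0 nT /forallP rkC]|[chC inC exC]].
  split=> // [x xC|k Sk].
    have x0 : (0 < #|x|)%N by rewrite card_gt0; apply: contraNneq n0 => <-.
    have xT : (#|x|.-1 < inner_rank (boolean_lattice r.+1))%N.
      rewrite rE -ltnS prednK // -[X in (_ < X)%N](card_ord r.+1) -cardsT.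
      by apply: proper_card; rewrite properT; apply: contraNneq nT => <-.
    split=> //; rewrite (nth_set_word S (Ordinal xT)) (eqP (rkC _)).
    by apply/exists_inP; exists x; rewrite // poset_rank_lattice /= prednK.
  have lt_k : (k < inner_rank (boolean_lattice r.+1))%N.
    rewrite -(size_set_word S) ltnNge; apply: contraTN Sk => le_k.
    by rewrite nth_default.
  move: Sk; rewrite (nth_set_word S (Ordinal lt_k)) (eqP (rkC _)).
  by case/exists_inP => x xC /eqP; rewrite poset_rank_lattice; exists x.
split=> //; first by apply/negP => /inC[_]; rewrite cards0.
  (* The position of the full set lies just past the end of the word, where [nth] returns
     [false]. *)
  by apply/negP => /inC[_ _]; rewrite cardsT card_ord /= nth_default // size_set_word rE.
apply/forallP => i; rewrite -nth_set_word; apply/eqP.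
apply/idP/exists_inP => [/exC[x xC cx]|[x xC]].
  by exists x; rewrite // poset_rank_lattice cx.
by rewrite poset_rank_lattice => /eqP cx; have [_ _] := inC x xC; rewrite cx.
Qed.

Lemma mem_belows p q : (q \in belows p) = all2 implb q p.
Proof.
elim: p q => [|x p IHp] [|y q] //.
- by apply/negbTE/negP => /size_belows.
- have mem_map_cons a b s : (a :: q \in map (cons b) s) = (a == b) && (q \in s).
    apply/mapP/andP => [[q' q's [-> ->]]|[/eqP-> qs]]; [by rewrite eqxx | by exists q].
  case: x => /=; rewrite ?mem_cat !mem_map_cons !IHp; by case: y => //=; rewrite ?orbF.
Qed.

Lemma uniq_belows p : uniq (belows p).
Proof.
have inj b : injective (cons b : seq bool -> seq bool) by move=> ? ? [].
elim: p => [|[] p IHp] //=; rewrite ?cat_uniq !map_inj_uniq ?IHp //= andbT.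
by apply/hasPn => _ /mapP[q _ ->]; apply/negP => /mapP[].
Qed.

Lemma all2_set_word r (U S : {set 'I_r}) : all2 implb (set_word U) (set_word S) = (U \subset S).
Proof.
rewrite /set_word all2E !size_map eqxx /= zip_map all_map.
apply/allP/subsetP => [h i iU|h i _ /=]; last by apply/implyP/h.
by have := h i; rewrite mem_enum /= iU => /(_ isT).
Qed.

Lemma big_belows_set_word r (K : seq bool -> int) (S : {set 'I_r}) :
  \sum_(q <- belows (set_word S)) K q = \sum_(U : {set 'I_r} | U \subset S) K (set_word U).
Proof.
have perm_S : perm_eq (belows (set_word S))
    [seq set_word U | U <- enum [pred U : {set 'I_r} | U \subset S]].
  apply: uniq_perm; rewrite ?uniq_belows ?map_inj_uniq ?enum_uniq //; first exact: set_word_inj.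
  move=> q; rewrite mem_belows; apply/idP/mapP => [q_le|[U]].
    have size_q : size q = r.
      by move: q_le; rewrite all2E size_set_word => /andP[/eqP].
    exists [set i : 'I_r | nth false q i]; last by rewrite set_wordK.
    by rewrite mem_enum inE -all2_set_word set_wordK.
  by rewrite mem_enum inE => sUS ->; rewrite all2_set_word.
by rewrite (perm_big _ perm_S) /= big_map big_enum.
Qed.

(** If [U] is a proper subset of [S], toggling an element of [S] outside [U] permutes the sets [V]
    and reverses the sign, so the sum equals its opposite. *)
Lemma sum_sign_subset (T : finType) (U S : {set T}) :
  \sum_(V : {set T} | (U \subset V) && (V \subset S)) (-1) ^+ #|S :\: V| = (U == S)%:R :> int.
Proof.
have [<-|neqUS] := eqVneq U S.
  rewrite (big_pred1 U) => [|V]; first by rewrite setDv cards0.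
  by rewrite -eqEsubset eq_sym.
have [sUS|nsUS] := boolP (U \subset S); last first.
  by rewrite big1 // => V /andP[sUV sVS]; case/negP: nsUS; apply: subset_trans sVS.
have [x xS nxU] : exists2 x, x \in S & x \notin U.
  by apply/subsetPn; apply: contra neqUS => sSU; rewrite eqEsubset sUS.
set s := LHS; suff : s = - s by lia.
pose f (V : {set T}) : {set T} := if x \in V then V :\ x else x |: V.
have fK : involutive f.
  move=> V; rewrite /f; case: (boolP (x \in V)) => xV.
    by rewrite !inE eqxx setD1K.
  by rewrite setU11 setU1K.
rewrite {1}/s (reindex_inj (inv_inj fK)) /= -sumrN.
apply: eq_big => [V|V _].
  rewrite /f; case: ifP => xV.
    rewrite subsetD1 nxU andbT subDset (setUidPr _) //; by rewrite sub1set.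
  rewrite subUset sub1set xS -subDset (setDidPl _) //.
  by rewrite disjoint_sym disjoints1.
have cardD (W : {set T}) : x \notin W -> #|S :\: W| = #|S :\: (x |: W)|.+1.
  by move=> nxW; rewrite (cardsD1 x) !inE xS nxW add1n setDDl setUC.
rewrite /f; case: (boolP (x \in V)) => xV; last by rewrite (cardD V) // exprS mulN1r opprK.
by rewrite cardD ?setD1K // ?exprS ?mulN1r // !inE eqxx.
Qed.

Lemma flag_h_lattice r (S : {set 'I_(inner_rank (boolean_lattice r.+1))}) :
  flag_h S = (hvec (set_word S))%:R.
Proof.
rewrite /flag_h.
transitivity (\sum_(V : {set 'I_(inner_rank (boolean_lattice r.+1))} | V \subset S)
   \sum_(U : {set 'I_(inner_rank (boolean_lattice r.+1))} | U \subset V)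
     (hvec (set_word U))%:R * (-1) ^+ #|S :\: V| : int).
  apply: eq_bigr => V _; rewrite flag_f_lattice /fvec natr_sum big_belows_set_word.
  by rewrite mulrC big_distrl.
rewrite (exchange_big_dep xpredT) //=.
rewrite (eq_bigr (fun U => (hvec (set_word U))%:R * (U == S)%:R)); last first.
  move=> U _; rewrite -big_distrr /= -sum_sign_subset; congr (_ * _).
  by apply: eq_bigl => V; rewrite andbC.
rewrite (bigD1 S) //= eqxx mulr1 big1 ?addr0 // => U /negbTE ->.
by rewrite mulr0.
Qed.

(** * The cd-index of the Boolean lattice *)

Lemma prod_letters (I : Type) (s : seq I) (B : I -> bool) :
  \prod_(i <- s) (if B i then vb else va) = << ab_monom (map B s) >>.
Proof.
elim: s => [|i s IHs].
  rewrite big_nil; apply/malgP => k; rewrite mcoeff1 mcoeffU1 eq_sym; congr ((_ == _)%:R).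
  by apply/eqP; rewrite fmP fm1.
rewrite big_cons IHs /=.
have letterM x p : << FMonom [:: ab_of_bool x] >> * << ab_monom p >> =
    << ab_monom (x :: p) >> :> ab_poly.
  rewrite malgM_def fgmulUU mul1r; congr mkmalgU; by apply/eqP; rewrite fmP fmM.
by case: (B i); [exact: (letterM true) | exact: (letterM false)].
Qed.

Lemma ab_monom_inj : injective ab_monom.
Proof. by move=> p q [] /inj_map; apply; case; case. Qed.

Lemma mcoeff_ab_index r p :
  (ab_index (boolean_lattice r.+1))@_(ab_monom p) = if size p == r then (hvec p)%:R else 0.
Proof.
have rE := inner_rank_lattice r.+1; rewrite /= in rE.
rewrite /ab_index raddf_sum /=.
rewrite (eq_bigr (fun S => (hvec p)%:R *+ (set_word S == p))); last first.
  move=> S _; rewrite mcoeffZ flag_h_lattice.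
  have -> : \prod_(i < inner_rank (boolean_lattice r.+1)) (if i \in S then vb else va) =
      << ab_monom (set_word S) >> 
    by rewrite -(prod_letters (enum _) (mem S)) enumT -[in RHS]/(index_enum _).
  rewrite mcoeffU1.
  rewrite (inj_eq ab_monom_inj) mulr_natr.
  by case: eqP => [->|].
case: eqP => [size_p|nsize_p].
  rewrite -rE in size_p.
  pose Sp := [set i : 'I_(inner_rank (boolean_lattice r.+1)) | nth false p i].
  rewrite (bigD1 Sp) //= set_wordK // eqxx.
  rewrite big1 ?addr0 // => S neqS; rewrite (_ : (_ == _) = false) //.
  apply: contraNF neqS => /eqP eqS; apply/eqP; apply: set_word_inj.
  by rewrite set_wordK.
rewrite big1 // => S _; rewrite (_ : (_ == _) = false) //; apply/eqP => eqS.
by apply: nsize_p; rewrite -eqS size_set_word.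
Qed.

Definition lattice_cd_index r : cd_poly :=
  \sum_(w <- cd_words r) << (beta0 w)%:R *g FMonom w >>.

Lemma lattice_cd_indexP r : is_cd_index (boolean_lattice r.+1) (lattice_cd_index r).
Proof.
apply/malgP => m; have [p ->] := ab_monomP m; rewrite mcoeff_ab_index.
have substD : {morph cd_subst : X Y / X + Y} by move=> X Y; exact: mmapD.
have subst0 : cd_subst 0 = 0 by exact: mmap0.
rewrite /lattice_cd_index (big_morph cd_subst substD subst0).
rewrite (big_morph (mcoeff (ab_monom p)) (@mcoeffD _ _ _) (mcoeff0 _)).
rewrite (eq_bigr (fun w => ((beta0 w) * expands p w)%N%:R)); last first.
  move=> w _; rewrite /cd_subst mmapU /= mulrzl raddfMz /=.
  by rewrite mcoeff_cd_subst_word mulrzz mulrC natrM.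
by rewrite -natr_sum big_cd_words_expands; case: ifP.
Qed.

(** The explicit polynomial [lattice_cd_index] shows that a cd-index exists, so the [epsilon] choice
    satisfies its specification; injectivity of [cd_subst] then identifies the two. *)
Lemma betaE v : beta v = (beta0 v)%:R.
Proof.
rewrite /beta; set P := boolean_lattice _.
have <- : lattice_cd_index (cd_deg v) = cd_index P.
  apply: cd_subst_inj; rewrite (lattice_cd_indexP (cd_deg v)); apply: esym.
  apply: (epsilon_spec (inhabits 0) (is_cd_index P)).
  exists (lattice_cd_index (cd_deg v)); exact: lattice_cd_indexP.
rewrite /lattice_cd_index raddf_sum /= -[RHS](big_cd_words_1 (fun w => (beta0 w)%:R)).
by apply: eq_bigr => w _; rewrite mcoeffU.
Qed.

Theorem theorem6p1 (n : nat) (n_ge1 : (1 <= n)%N) :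
  (forall v : seq cd_letter, cd_deg v = (2 * n + 2)%N ->
     beta v <= beta ([:: Lc] ++ nseq n Ld ++ [:: Lc])) /\
  (forall v : seq cd_letter, cd_deg v = (2 * n + 5)%N ->
     beta v <= beta ([:: Lc; Ld; Lc] ++ nseq n Ld ++ [:: Lc]) /\
     beta v <= beta ([:: Lc] ++ nseq n Ld ++ [:: Lc; Ld; Lc])).
Proof.
split=> v dv; rewrite !betaE !ler_nat; first exact: beta0_even_max.
exact: beta0_odd_max.
Qed.
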